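(* Let $G(4,2)=F_4/\Gamma_3(F_4)$ be the free nilpotent group of nilpotency class $2$ on four generators $x,y,z,w$. The quotient of $G(4,2)$ by the subgroup generated by the commutators $[x,z]$, $[x,w]$, $[y,z]$ is a group of nilpotency class $2$ which has the $R_\infty$ property.
   Context: $F_4$ is the free group on $x,y,z,w$ and $\Gamma_i(F_4)$ is the $i$-th term of its lower central series, with $\Gamma_1(F_4)=F_4$ and $\Gamma_{i+1}(F_4)=[\Gamma_i(F_4),F_4]$. For an endomorphism $\varphi:G\to G$ of a group, $G$ acts on itself by $\sigma\cdot\alpha=\sigma\alpha\varphi(\sigma)^{-1}$. The Reidemeister number $R(\varphi)$ is the number of orbits ($\infty$ if there are infinitely many). A group $G$ has the $R_\infty$ property if $R(\varphi)=\infty$ for every automorphism $\varphi$ of $G$. *)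

(* Defs.v *)
From HB Require Import structures.
From mathcomp Require Import all_boot finmap.
From mathcomp Require Import boolp classical_sets functions cardinality.

Set Implicit Arguments.
Unset Strict Implicit.
Unset Printing Implicit Defensive.

Local Open Scope classical_set_scope.
Local Open Scope group_scope.
Local Open Scope quotient_scope.

Section Subgroups.
Variable G : groupType.
Implicit Types A B : set G.

Definition is_subgroup A : Prop :=
  [/\ A 1, forall a b, A a -> A b -> A (a * b) & forall a, A a -> A a^-1].

Definition is_normal A : Prop := forall a g, A a -> A (a ^ g).

Definition generated A : set G := smallest is_subgroup A.

(* [~ a, b] is a^-1 * b^-1 * a * b. The convention a * b * a^-1 * b^-1 yields *)
(* the same lower central series, and the same commutators in class 2.        *)
Definition commutator_subgroup A B : set G :=
  generated [set g | exists a b, [/\ A a, B b & g = [~ a, b]]].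

(* The n-th term is indexed from 1, as for 'L_n(G) in mathcomp.solvable: *)
(* terms 0 and 1 are both the whole group.                               *)
Definition lower_central (n : nat) : set G :=
  iter n.-1 (fun A => commutator_subgroup A setT) setT.

Definition has_nilpotency_class (c : nat) : Prop :=
  lower_central c.+1 = [set 1] /\
  forall d, (d < c)%N -> lower_central d.+1 <> [set 1].

Record normalSubgroup := NormalSubgroup {
  nsg_set : set G;
  nsg_subgroup : is_subgroup nsg_set;
  nsg_normal : is_normal nsg_set }.

Lemma generated_subgroup A : is_subgroup (generated A).
Proof.
split=> [B [[B1 _ _] _] //|a b Aa Ab B sB|a Aa B sB].
  by case: (sB) => -[_ BM _] _; apply: BM; [apply: Aa|apply: Ab].
by case: (sB) => -[_ _ BV] _; apply: BV; apply: Aa.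
Qed.

Lemma conj_preim_subgroup A g :
  is_subgroup A -> is_subgroup [set a | A (a ^ g)].
Proof.
move=> [A1 AM AV]; split=> [|a b /= Aa Ab|a /= Aa].
- by rewrite /= conj1g.
- by rewrite conjMg; apply: AM.
- by rewrite conjVg; apply: AV.
Qed.

Lemma generated_normal A : is_normal A -> is_normal (generated A).
Proof.
move=> nA a g; apply: (@smallest_sub _ is_subgroup A
  [set h | generated A (h ^ g)]).
  exact/conj_preim_subgroup/generated_subgroup.
by move=> b Ab /=; apply: sub_gen_smallest; apply: nA.
Qed.

Lemma lower_central_subgroup n : is_subgroup (lower_central n).
Proof.
rewrite /lower_central; case: n.-1 => [|k]; first by split.
exact: generated_subgroup.
Qed.

Lemma lower_central_normal n : is_normal (lower_central n).
Proof.
rewrite /lower_central; elim: n.-1 => [|k IHk] //=.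
apply: generated_normal => _ g [a [b [Aa _ ->]]].
by exists (a ^ g), (b ^ g); split=> //; [apply: IHk | rewrite conjRg].
Qed.

Definition lower_central_nsg (n : nat) : normalSubgroup :=
  NormalSubgroup (@lower_central_subgroup n) (@lower_central_normal n).

End Subgroups.

Arguments lower_central G n : clear implicits.
Arguments has_nilpotency_class G c : clear implicits.
Arguments lower_central_nsg G n : clear implicits.

Section QuotientGroup.
Variables (G : groupType) (N : normalSubgroup G).

Definition nsg_rel : rel G := fun a b => `[< nsg_set N (a^-1 * b) >].

Lemma nsg_rel_equiv : equiv_class_of nsg_rel.
Proof.
have [N1 NM NV] := nsg_subgroup N; split=> [a|a b|b a c].
- by apply/asboolP; rewrite mulVg.
- by apply/asboolP/asboolP => /NV; rewrite invgM invgK.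
- move=> /asboolP Nab /asboolP Nbc; apply/asboolP.
  by have := NM _ _ Nab Nbc; rewrite mulgA mulgK.
Qed.
Canonical nsg_equiv_rel := EquivRelPack nsg_rel_equiv.

Definition quotient_group := {eq_quot nsg_equiv_rel}.
HB.instance Definition _ := Choice.on quotient_group.
HB.instance Definition _ := EqQuotient.on quotient_group.

Lemma quotient_eqP a b :
  reflect (a = b %[mod quotient_group]) `[< nsg_set N (a^-1 * b) >].
Proof. exact: eqmodP. Qed.

Definition quotient_one : quotient_group := \pi_quotient_group 1.
Definition quotient_inv (u : quotient_group) : quotient_group :=
  \pi_quotient_group (repr u)^-1.
Definition quotient_mul (u v : quotient_group) : quotient_group :=
  \pi_quotient_group (repr u * repr v).

Lemma quotient_piM a b :
  quotient_mul (\pi_quotient_group a) (\pi_quotient_group b) =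
  \pi_quotient_group (a * b).
Proof.
have [_ NM _] := nsg_subgroup N.
have /quotient_eqP/asboolP Na :
    repr (\pi_quotient_group a) = a %[mod quotient_group].
  by rewrite reprK.
have /quotient_eqP/asboolP Nb :
    repr (\pi_quotient_group b) = b %[mod quotient_group].
  by rewrite reprK.
apply/quotient_eqP/asboolP; move: (repr _) (repr _) Na Nb => a' b' Na Nb.
have := NM _ _ Nb (@nsg_normal _ N _ b Na).
by rewrite conjgE !mulgA mulgK invgM.
Qed.

Lemma quotient_piV a : quotient_inv (\pi_quotient_group a) =
  \pi_quotient_group a^-1.
Proof.
have /quotient_eqP/asboolP Na :
    a = repr (\pi_quotient_group a) %[mod quotient_group].
  by rewrite reprK.
apply/quotient_eqP/asboolP; move: (repr _) Na => a' Na.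
by have := @nsg_normal _ N _ a^-1 Na; rewrite conjgE !invgK !mulgA mulgV mul1g.
Qed.

Lemma quotient_mulA : associative quotient_mul.
Proof.
elim/quotW=> a; elim/quotW=> b; elim/quotW=> c.
by rewrite (quotient_piM b c) (quotient_piM a) (quotient_piM a b)
           (quotient_piM _ c) mulgA.
Qed.

Lemma quotient_mul1 : left_id quotient_one quotient_mul.
Proof. by elim/quotW=> a; rewrite quotient_piM mul1g. Qed.

Lemma quotient_mulr1 : right_id quotient_one quotient_mul.
Proof. by elim/quotW=> a; rewrite quotient_piM mulg1. Qed.

Lemma quotient_mulV : left_inverse quotient_one quotient_inv quotient_mul.
Proof. by elim/quotW=> a; rewrite quotient_piV quotient_piM mulVg. Qed.

Lemma quotient_mulrV : right_inverse quotient_one quotient_inv quotient_mul.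
Proof. by elim/quotW=> a; rewrite quotient_piV quotient_piM mulgV. Qed.

HB.instance Definition _ := isGroup.Build quotient_group quotient_mulA
  quotient_mul1 quotient_mulr1 quotient_mulV quotient_mulrV.

Lemma quotient_pi_morph : monoid_morphism \pi_quotient_group.
Proof. by split=> // a b; rewrite -(quotient_piM a b). Qed.

HB.instance Definition _ := isUMagmaMorphism.Build G quotient_group
  \pi_quotient_group quotient_pi_morph.

End QuotientGroup.

Lemma quotient_lower_central3 (G : groupType)
    (u v t : quotient_group (lower_central_nsg G 3)) :
  [~ u, v] ^ t = [~ u, v].
Proof.
apply/eqP; rewrite conjg_fix; apply/eqP.
elim/quotW: u => a; elim/quotW: v => b; elim/quotW: t => c.
pose p : UMagmaMorphism.type G _ :=
  \pi_(quotient_group (lower_central_nsg G 3)).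
rewrite -(gmulfR p a b) -(gmulfR p _ c).
apply/esym/quotient_eqP/asboolP; rewrite invg1 mul1g.
apply: sub_gen_smallest; exists [~ a, b], c; split=> //.
by apply: sub_gen_smallest; exists a, b.
Qed.

Section FreeGroup.
Variable T : choiceType.

(* The letter (t, true) stands for t and (t, false) for its inverse. *)
Definition letter : Type := T * bool.
HB.instance Definition _ := Choice.on letter.
Definition letter_inv (l : letter) : letter := (l.1, ~~ l.2).

Inductive free_eq : seq letter -> seq letter -> Prop :=
| free_eq_refl u : free_eq u u
| free_eq_sym u v : free_eq u v -> free_eq v u
| free_eq_trans v u w : free_eq u v -> free_eq v w -> free_eq u w
| free_eq_cancel u l v : free_eq (u ++ [:: l, letter_inv l & v]) (u ++ v).

Definition free_rel : rel (seq letter) := fun u v => `[< free_eq u v >].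

Lemma free_rel_equiv : equiv_class_of free_rel.
Proof.
split=> [u|u v|v u w]; first exact/asboolP/free_eq_refl.
  by apply/asboolP/asboolP; apply: free_eq_sym.
by move=> /asboolP uv /asboolP vw; apply/asboolP/(free_eq_trans uv).
Qed.
Canonical free_equiv_rel := EquivRelPack free_rel_equiv.

Definition free_group := {eq_quot free_equiv_rel}.
HB.instance Definition _ := Choice.on free_group.
HB.instance Definition _ := EqQuotient.on free_group.

Lemma free_eqP u v : (u = v %[mod free_group]) <-> free_eq u v.
Proof.
split; first by move/eqmodP/asboolP.
by move=> uv; apply/eqmodP/asboolP.
Qed.

Lemma free_eq_cat u u' v v' :
  free_eq u u' -> free_eq v v' -> free_eq (u ++ v) (u' ++ v').
Proof.
move=> uu' vv'; apply: (@free_eq_trans (u' ++ v)).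
  elim: uu' v {vv'} => {u u'} [u|u w _ IH|w u x _ IH1 _ IH2|u l w] v.
  - exact: free_eq_refl.
  - exact/free_eq_sym/IH.
  - exact: free_eq_trans (IH1 v) (IH2 v).
  - rewrite -!catA; exact: free_eq_cancel.
elim: vv' {uu'} => {u v v'} [u|u w _ IH|w u x _ IH1 _ IH2|u l w].
- exact: free_eq_refl.
- exact/free_eq_sym.
- exact: free_eq_trans IH1 IH2.
- rewrite !catA; exact: free_eq_cancel.
Qed.

Definition word_inv (u : seq letter) : seq letter := rev (map letter_inv u).

Lemma letter_invK : involutive letter_inv.
Proof. by case=> t b; rewrite /letter_inv negbK. Qed.

Lemma word_invK : involutive word_inv.
Proof.
by move=> u; rewrite /word_inv map_rev revK mapK //; apply: letter_invK.
Qed.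

Lemma free_eq_inv u v : free_eq u v -> free_eq (word_inv u) (word_inv v).
Proof.
elim=> {u v} [u|u w _ IH|w u x _ IH1 _ IH2|u l w].
- exact: free_eq_refl.
- exact: free_eq_sym.
- exact: free_eq_trans IH1 IH2.
- rewrite /word_inv !map_cat !rev_cat /= !rev_cons -!cats1 -!catA /=.
  rewrite letter_invK.
  exact: free_eq_cancel.
Qed.

Lemma free_eq_invr u : free_eq (u ++ word_inv u) [::].
Proof.
elim: u => [|l u IHu]; first exact: free_eq_refl.
rewrite /word_inv /= rev_cons -cats1 -(cat1s l (u ++ _)).
apply: (@free_eq_trans ([:: l] ++ [:: letter_inv l])).
  apply: free_eq_cat; first exact: free_eq_refl.
  by rewrite catA; apply: (free_eq_cat IHu); apply: free_eq_refl.
exact: (free_eq_cancel [::] l [::]).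
Qed.

Lemma free_eq_invl u : free_eq (word_inv u ++ u) [::].
Proof. by rewrite -{2}[u]word_invK; apply: free_eq_invr. Qed.

Definition free_one : free_group := \pi_free_group [::].
Definition free_inv (a : free_group) : free_group :=
  \pi_free_group (word_inv (repr a)).
Definition free_mul (a b : free_group) : free_group :=
  \pi_free_group (repr a ++ repr b).

Lemma free_piM u v : free_mul (\pi_free_group u) (\pi_free_group v) =
  \pi_free_group (u ++ v).
Proof. by apply/free_eqP/free_eq_cat; apply/free_eqP; rewrite reprK. Qed.

Lemma free_piV u : free_inv (\pi_free_group u) = \pi_free_group (word_inv u).
Proof. by apply/free_eqP/free_eq_inv; apply/free_eqP; rewrite reprK. Qed.

Lemma free_mulA : associative free_mul.
Proof.
elim/quotW=> u; elim/quotW=> v; elim/quotW=> w.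
by rewrite (free_piM v w) (free_piM u) (free_piM u v) (free_piM _ w) catA.
Qed.

Lemma free_mul1 : left_id free_one free_mul.
Proof. by elim/quotW=> u; rewrite free_piM. Qed.

Lemma free_mulr1 : right_id free_one free_mul.
Proof. by elim/quotW=> u; rewrite free_piM cats0. Qed.

Lemma free_mulV : left_inverse free_one free_inv free_mul.
Proof.
by elim/quotW=> u; rewrite free_piV free_piM; apply/free_eqP/free_eq_invl.
Qed.

Lemma free_mulrV : right_inverse free_one free_inv free_mul.
Proof.
by elim/quotW=> u; rewrite free_piV free_piM; apply/free_eqP/free_eq_invr.
Qed.

HB.instance Definition _ := isGroup.Build free_group free_mulA
  free_mul1 free_mulr1 free_mulV free_mulrV.

Definition free_gen (t : T) : free_group := \pi_free_group [:: (t, true)].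

End FreeGroup.

Section Reidemeister.
Variables (G : groupType) (phi : {multiplicative G -> G}).

Definition twisted_orbit (a : G) : set G :=
  [set s * a * (phi s)^-1 | s in [set: G]].

Definition twisted_orbits : set (set G) := range twisted_orbit.

(* Some n when there are exactly n orbits, None when there are infinitely *)
(* many.                                                                  *)
Definition reidemeister_number : option nat :=
  if pselect (finite_set twisted_orbits)
  then Some #|` fset_set twisted_orbits|%fset else None.

End Reidemeister.

Definition R_infinity (G : groupType) : Prop :=
  forall phi : {multiplicative G -> G},
    bijective phi -> reidemeister_number phi = None.

Definition free_nilpotent (r c : nat) : groupType :=
  quotient_group (lower_central_nsg (free_group 'I_r) c.+1).

Definition free_nilpotent_gen (r c : nat) (i : 'I_r) : free_nilpotent r c :=
  \pi_(quotient_group _) (free_gen i).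

Section Quotient42.

Let x : free_nilpotent 4 2 := free_nilpotent_gen 2 (@Ordinal 4 0 isT).
Let y : free_nilpotent 4 2 := free_nilpotent_gen 2 (@Ordinal 4 1 isT).
Let z : free_nilpotent 4 2 := free_nilpotent_gen 2 (@Ordinal 4 2 isT).
Let w : free_nilpotent 4 2 := free_nilpotent_gen 2 (@Ordinal 4 3 isT).

Definition relator_subgroup : set (free_nilpotent 4 2) :=
  generated [set [~ x, z]; [~ x, w]; [~ y, z]].

(* Normal because commutators are central in class 2. *)
Lemma relator_normal : is_normal relator_subgroup.
Proof.
by apply: generated_normal => _ g [[]|] ->;
  rewrite quotient_lower_central3; [left; left|left; right|right].
Qed.

Definition relator_nsg : normalSubgroup (free_nilpotent 4 2) :=
  NormalSubgroup (@generated_subgroup _ _) relator_normal.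

End Quotient42.

(* Main.v *)
(* Let Q be the quotient, with the generators ordered x, y, w, z along the    *)
(* path of the non-commuting pairs. An element of Q is central iff its image  *)
(* in Z^4 vanishes, so an automorphism phi of Q induces an M in GL_4(Z)       *)
(* compatible with the commutation relation. The centralizers of x and z have *)
(* rank 3 modulo the centre, which forces M to fix or to exchange the lines   *)
(* of x and z, and hence to act on <y, w>, modulo x and z, by a signed        *)
(* permutation. Either M has eigenvalue 1, and a fixed linear form on Z^4 is  *)
(* then constant on the twisted orbits; or M has no nonzero fixed vector and  *)
(* acts on <y, w> with determinant 1. In the second case phi maps t = [y, w]  *)
(* to t modulo [x, y] and [w, z], and the powers of t lie in distinct twisted *)
(* orbits.                                                                    *)

From HB Require Import structures.
Require Import Defs.
From mathcomp Require Import all_boot all_algebra.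
From mathcomp Require Import boolp classical_sets cardinality.
From mathcomp Require Import ring lra zify.
Set Implicit Arguments.
Unset Strict Implicit.
Unset Printing Implicit Defensive.
Import GRing.Theory.
Local Open Scope classical_set_scope.
Local Open Scope group_scope.
Local Open Scope quotient_scope.

(** Commutators in Q are central and bilinear, so most of the argument is integer linear algebra on
    Z^4, where [vec] records exponents. By [vec0_centre] and [centre_ab] the kernel of [vec] is the
    centre. An automorphism phi respects the centre and commutation, and hence induces an invertible
    matrix M that preserves [path_commute].

    Such matrices are rigid: by [path_aut_fixed] there are two cases. If l M = l for some l <> 0,
    then l is constant on twisted orbits and separates the powers of any element on which it does
    not vanish. Otherwise M has no nonzero fixed vector and has determinant 1 on the y, w block. Let
    t = [y, w] and suppose s t^m = t^n phi(s). Then [vec s] is fixed by M, hence zero. Since the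
    determinant is 1, delta(phi g) - delta(g) is additive in g, so it vanishes at s; comparing
    [delta] on both sides gives m = n.

    The class is exactly 2 because t survives in the concrete group [step2 edges]. *)

Section IntegerPowers.
Variable G : groupType.

Definition expgz (a : G) (n : int) : G :=
  match n with Posz k => a ^+ k | Negz k => a ^- k.+1 end.

Lemma expgzS a n : expgz a (n + 1)%R = a * expgz a n.
Proof.
case: n => [k|[|k]].
- by rewrite -PoszD addn1 /= expgS.
- by rewrite /= expg1 mulgV.
- have -> : (Negz k.+1 + 1 = Negz k)%R by lia.
  by rewrite /= [a ^+ k.+2]expgSr invgM mulgA mulgV mul1g.
Qed.

Lemma expgzD a m n : expgz a (m + n)%R = expgz a m * expgz a n.
Proof.
have S k : expgz a (k - 1)%R = a^-1 * expgz a k.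
  by rewrite -{2}[k](subrK 1%R) expgzS mulKg.
elim: m => [|m IHm|m IHm]; first by rewrite add0r mul1g.
- have -> : (m.+1%:Z + n = m%:Z + n + 1)%R by lia.
  by rewrite expgzS IHm mulgA /= -expgS.
- have -> : (- m.+1%:Z + n = - m%:Z + n - 1)%R by lia.
  rewrite S IHm mulgA -S; congr (expgz a _ * _); lia.
Qed.

End IntegerPowers.

(** * Universal properties of free groups and quotients *)

Section FreeLift.
Variables (T : choiceType) (H : groupType) (u : T -> H).

Definition letter_eval (l : letter T) : H := if l.2 then u l.1 else (u l.1)^-1.
Definition word_eval (s : seq (letter T)) : H := \prod_(l <- s) letter_eval l.

Lemma word_eval_eq s t : free_eq s t -> word_eval s = word_eval t.
Proof.
elim=> // {s t} [s t r _ -> _ -> //|s [t b] r].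
rewrite /word_eval !big_cat !big_cons /= /letter_eval /=.
by case: b; rewrite /= ?mulKg ?mulVKg.
Qed.

Definition free_lift (g : free_group T) : H := word_eval (repr g).

Lemma free_lift_pi s : free_lift (\pi_(free_group T) s) = word_eval s.
Proof. by apply: word_eval_eq; apply/free_eqP; rewrite reprK. Qed.

Lemma free_lift_morph : monoid.monoid_morphism free_lift.
Proof.
split; first by rewrite free_lift_pi /word_eval big_nil.
elim/quotW=> s; elim/quotW=> t.
by rewrite [_ * _]free_piM !free_lift_pi /word_eval big_cat.
Qed.

HB.instance Definition _ :=
  isUMagmaMorphism.Build (free_group T) H free_lift free_lift_morph.

Lemma free_lift_gen t : free_lift (free_gen t) = u t.
Proof. by rewrite free_lift_pi /word_eval big_seq1. Qed.

End FreeLift.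

Lemma free_group_ind (T : choiceType) (A : set (free_group T)) :
  is_subgroup A -> (forall t, A (free_gen t)) -> forall g, A g.
Proof.
move=> [A1 AM AV] Ag; elim/quotW; elim=> [//|[t b] s IHs].
rewrite -cat1s -free_piM; apply: AM => //; case: b; first exact: Ag.
by have := AV _ (Ag t); rewrite -[_^-1]/(free_inv _) free_piV.
Qed.

Lemma quotient_lift (G H : groupType) (N : normalSubgroup G)
    (f : UMagmaMorphism.type G H) :
  (forall a, nsg_set N a -> f a = 1) ->
  exists g : UMagmaMorphism.type (quotient_group N) H,
    forall a, g (\pi_(quotient_group N) a) = f a.
Proof.
move=> fN; pose g (u : quotient_group N) := f (repr u).
have gE a : g (\pi_(quotient_group N) a) = f a.
  have /quotient_eqP/asboolP/fN :
      repr (\pi_(quotient_group N) a) = a %[mod quotient_group N].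
    by rewrite reprK.
  by rewrite gmulfM gmulfV => /mulg1_eq; rewrite invgK.
have g_morph : monoid.monoid_morphism g.
  split; first by rewrite gE gmulf1.
  by elim/quotW=> a; elim/quotW=> b; rewrite [_ * _]quotient_piM !gE gmulfM.
pose gM := isUMagmaMorphism.Build _ _ g g_morph.
by exists (HB.pack_for (UMagmaMorphism.type (quotient_group N) H) g gM).
Qed.

Lemma lower_central2_min (G : groupType) (A : set G) : is_subgroup A ->
  (forall a b, A [~ a, b]) -> lower_central G 2 `<=` A.
Proof.
by move=> sA cA; apply: smallest_sub => // _ [a [b [_ _ ->]]].
Qed.

(** * The centre and the lower central series *)

Definition centre (G : groupType) : set G := [set c | forall g, commute c g].

Lemma centre_subgroup (G : groupType) : is_subgroup (@centre G).
Proof.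
split=> [g|a b Ca Cb g|a Ca g]; apply: commute_sym.
- exact: commute1.
- by apply: commuteM; apply: commute_sym.
- by apply: commuteV; apply: commute_sym.
Qed.

Lemma lower_central3_eq1 (G : groupType) :
  (forall a b, centre [~ a, b :> G]) -> lower_central G 3 = [set 1].
Proof.
move=> cG; apply/seteqP; split; last first.
  by move=> _ ->; case: (lower_central_subgroup G 3).
apply: smallest_sub.
  by split=> [//|a b -> ->|a ->]; rewrite ?mulg1 ?invg1.
move=> _ [a [b [/(lower_central2_min (centre_subgroup G) cG) Ca _ ->]]].
exact/eqP/commgP/Ca.
Qed.

Lemma lower_central_morph (G H : groupType) (f : UMagmaMorphism.type G H) n a :
  lower_central G n a -> lower_central H n (f a).
Proof.
rewrite /lower_central; elim: n.-1 a => [//|k IHk] a /=.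
move=> Aa; set B := commutator_subgroup _ _.
have [B1 BM BV] : is_subgroup B by apply: generated_subgroup.
suff: (f @^-1` B) a by [].
apply: Aa; split=> [|_ [b [c [Ab _ ->]]]].
  split=> [|b c /= Bb Bc|b /= Bb]; rewrite /= ?gmulf1 ?gmulfM ?gmulfV //.
    exact: BM.
  exact: BV.
rewrite /= gmulfR; apply: sub_gen_smallest; exists (f b), (f c); split=> //.
exact: IHk.
Qed.

(** * Integer matrices that preserve the commutation relation of the path *)

Section PathForm.
Local Open Scope ring_scope.

(* Coordinates in the order x, y, w, z of the path of non-commuting pairs.    *)
Record vec4 := Vec4 { cx : int; cy : int; cw : int; cz : int }.

Definition comb3 a b c (u v t : vec4) : Prop :=
  [/\ a * cx u + b * cx v + c * cx t = 0, a * cy u + b * cy v + c * cy t = 0,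
      a * cw u + b * cw v + c * cw t = 0 & a * cz u + b * cz v + c * cz t = 0].

Definition indep3 u v t : Prop :=
  forall a b c, comb3 a b c u v t -> [/\ a = 0, b = 0 & c = 0].

(** Each equation is the vanishing of one exponent, of [x, y], [y, w] or [w, z], in a commutator. *)
Definition path_commute (u v : vec4) : Prop :=
  [/\ cx u * cy v = cy u * cx v, cy u * cw v = cw u * cy v &
      cw u * cz v = cz u * cw v].

(** The reflection of the path; it transfers [commuting_cy0] to the w-coordinate. *)
Definition flip4 u := Vec4 (cz u) (cw u) (cy u) (cx u).

Lemma path_commute_flip u v :
  path_commute u v -> path_commute (flip4 u) (flip4 v).
Proof. by case: u v => [? ? ? ?] [? ? ? ?] [/= H1 H2 H3]; split=> /=; lra. Qed.

Lemma path_commute_sym u v : path_commute u v -> path_commute v u.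
Proof. by case=> H1 H2 H3; split; lra. Qed.

Lemma indep3_flip u v t : indep3 u v t -> indep3 (flip4 u) (flip4 v) (flip4 t).
Proof. by move=> I a b c [/= H1 H2 H3 H4]; apply: I. Qed.

(** If the y-coordinate of u is nonzero, the vectors commuting with u have rank at most 2: up to
    multiples, they lie in the span of u and the z-axis. *)
Lemma commuting_cy0 u v t : path_commute u v -> path_commute u t ->
  indep3 u v t -> cy u = 0.
Proof.
case: u v t => [p q r s] [p1 q1 r1 s1] [p2 q2 r2 s2].
move=> [/= H1 H2 H3] [/= K1 K2 K3] I.
(* If q <> 0, then q v - q1 u and q t - q2 u are both supported on z. *)
pose t1 := q * s1 - q1 * s; pose t2 := q * s2 - q2 * s.
have [] := I (t2 * q1 - t1 * q2) (- t2 * q) (t1 * q).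
  split=> /=; last by rewrite /t1 /t2; ring.
  - transitivity (t2 * (p * q1 - q * p1) - t1 * (p * q2 - q * p2)); first ring.
    by rewrite H1 K1; ring.
  - ring.
  - transitivity (t1 * (q * r2 - r * q2) - t2 * (q * r1 - r * q1)); first ring.
    by rewrite H2 K2; ring.
move=> _ _ /eqP; rewrite mulf_eq0 => /orP[/eqP t10|/eqP //].
have [] // := I (- q1) q 0.
by split=> /=; move: t10; rewrite /t1; lra.
Qed.

Lemma commuting_cw0 u v t : path_commute u v -> path_commute u t ->
  indep3 u v t -> cw u = 0.
Proof.
move=> /path_commute_flip uv /path_commute_flip ut /indep3_flip.
exact: commuting_cy0 uv ut.
Qed.

(** Both u and v lie in the plane of x and z. Commuting with t makes [cx u * cy t] and [cz u * cw t]
    vanish; if both coordinates of u were nonzero, t would lie in that plane too, and three vectors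
    there are dependent. *)
Lemma commuting_end u v t : path_commute u v -> path_commute u t ->
  indep3 u v t -> cy v = 0 -> cw v = 0 ->
  (cz u = 0 /\ cy t = 0) \/ (cx u = 0 /\ cw t = 0).
Proof.
move=> uv ut I; have := commuting_cw0 uv ut I; have := commuting_cy0 uv ut I.
move: uv ut I.
case: u v t => [p q r s] [p1 q1 r1 s1] [p2 q2 r2 s2] /= _ + + q0 r0 q10 r10.
rewrite {}q0 {}r0 {}q10 {}r10 => -[/= K1 K2 K3] I {q r q1 r1}.
have [p0|p0] := eqVneq p 0.
  right; split=> //; apply/eqP; have /eqP : s * r2 = 0 by lra.
  rewrite mulf_eq0 => /orP[/eqP s0|//].
  have [] // := I 1 0 0.
  by split=> /=; rewrite ?p0 ?s0; ring.
have q20 : q2 = 0.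
  apply/eqP; have /eqP : p * q2 = 0 by lra.
  by rewrite mulf_eq0 (negPf p0).
left; split=> //; apply/eqP; apply/negPn/negP => s0.
have r20 : r2 = 0.
  apply/eqP; have /eqP : s * r2 = 0 by lra.
  by rewrite mulf_eq0 (negPf s0).
(* The coefficients are the 2 by 2 minors in the x and z coordinates. *)
have [|_ _ D0] := I (p1 * s2 - s1 * p2) (s * p2 - p * s2) (p * s1 - s * p1).
  by split=> /=; rewrite ?q20 ?r20; ring.
have [|_ /eqP] := I (- p1) p 0; last by rewrite (negPf p0).
by split=> /=; move: D0; lra.
Qed.

Definition comb4 a b c d (x y w z : vec4) : vec4 :=
  Vec4 (a * cx x + b * cx y + c * cx w + d * cx z)
       (a * cy x + b * cy y + c * cy w + d * cy z)
       (a * cw x + b * cw y + c * cw w + d * cw z)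
       (a * cz x + b * cz y + c * cz w + d * cz z).

Definition dot4 (u v : vec4) : int :=
  cx u * cx v + cy u * cy v + cw u * cw v + cz u * cz v.

Definition zero4 := Vec4 0 0 0 0.

Lemma mulz1_pm1 (a b : int) : a * b = 1 -> b = 1 \/ b = -1.
Proof.
by move=> ab; case/orP: (intUnitRing.unitzPl ab) => /eqP; [left|right].
Qed.

Section PathAutomorphism.
Variables x y w z : vec4.
Hypothesis free4 : forall a b c d, comb4 a b c d x y w z = zero4 ->
  [/\ a = 0, b = 0, c = 0 & d = 0].
Hypotheses (comm_xz : path_commute x z) (comm_xw : path_commute x w).
Hypothesis comm_yz : path_commute y z.

Let Ixzw : indep3 x z w.
Proof.
move=> a b c [H1 H2 H3 H4].
have [] // := free4 (a := a) (b := 0) (c := c) (d := b).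
by congr Vec4; lra.
Qed.

Let Izxy : indep3 z x y.
Proof.
move=> a b c [H1 H2 H3 H4].
have [] // := free4 (a := b) (b := c) (c := 0) (d := a).
by congr Vec4; lra.
Qed.

Lemma path_aut_ends : [/\ cy x = 0, cw x = 0, cy z = 0 & cw z = 0].
Proof.
have comm_zx := path_commute_sym comm_xz.
have comm_zy := path_commute_sym comm_yz.
split; [exact: commuting_cy0 Ixzw|exact: commuting_cw0 Ixzw|
        exact: commuting_cy0 Izxy|exact: commuting_cw0 Izxy].
Qed.

(** Of the four outcomes of [commuting_end] at the two ends, the mixed ones put the images of x and
    z on one axis, against independence. *)
Lemma path_aut_cases :
  [/\ cz x = 0, cy w = 0, cx z = 0 & cw y = 0] \/
  [/\ cx x = 0, cw w = 0, cz z = 0 & cy y = 0].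
Proof.
have comm_zx := path_commute_sym comm_xz.
have comm_zy := path_commute_sym comm_yz.
have [x2 x3 z2 z3] := path_aut_ends.
have x_neq0 : cx x = 0 -> cz x = 0 -> False.
  move=> x1 x4; have [] // := @Ixzw 1 0 0.
  by split; rewrite ?x1 ?x2 ?x3 ?x4; ring.
case: (commuting_end comm_xz comm_xw Ixzw z2 z3) => -[x0 w0];
case: (commuting_end comm_zx comm_zy Izxy x2 x3) => -[z0 y0].
- case: x_neq0 => //; have [|_ /eqP] := @Ixzw (cx z) (- cx x) 0.
    by split; rewrite ?x0 ?x2 ?x3 ?z0 ?z2 ?z3; ring.
  by rewrite oppr_eq0 => /eqP.
- by left.
- by right.
- case: x_neq0 => //; have [|_ /eqP] := @Ixzw (cz z) (- cz x) 0.
    by split; rewrite ?x0 ?x2 ?x3 ?z0 ?z2 ?z3; ring.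
  by rewrite oppr_eq0 => /eqP.
Qed.

Hypothesis onto4 : forall v, exists a b c d, comb4 a b c d x y w z = v.

(** The four vectors are the columns of M, so the first alternative says l M = l, and the last
    clause excludes nonzero solutions of M v = v. Surjectivity makes the nonzero entries of the y, w
    block units. *)
Lemma path_aut_fixed :
  (exists2 l, l <> zero4 & [/\ dot4 l x = cx l, dot4 l y = cy l,
                               dot4 l w = cw l & dot4 l z = cz l]) \/
  cy y * cw w - cw y * cy w = 1 /\
  (forall a b c d, comb4 a b c d x y w z = Vec4 a b c d ->
     [/\ a = 0, b = 0, c = 0 & d = 0]).
Proof.
have [a1 [b1 [c1 [d1 [_ eY _ _]]]]] := onto4 (Vec4 0 1 0 0).
have [a2 [b2 [c2 [d2 [_ _ eW _]]]]] := onto4 (Vec4 0 0 1 0).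
have := path_aut_ends; have := path_aut_cases.
move: eY eW; rewrite /dot4 /comb4.
case: x y w z => [p q r s] [p1 q1 r1 s1] [p2 q2 r2 s2] [p3 q3 r3 s3] /=.
move=> eY eW cases [q0 r0 q30 r30]; move: eY eW cases.
rewrite {}q0 {}r0 {}q30 {}r30 => eY eW [[s0 q20 p30 r10]|[p0 r20 s30 q10]].
- move: eY eW; rewrite {}s0 {}q20 {}p30 {}r10 => eY eW.
  have [q11|q1N] : q1 = 1 \/ q1 = -1 by apply: (@mulz1_pm1 b1); lra.
    left; exists (Vec4 0 1 0 0); first by [].
    by rewrite /= q11; split; ring.
  have [r21|r2N] : r2 = 1 \/ r2 = -1 by apply: (@mulz1_pm1 c2); lra.
    left; exists (Vec4 0 0 1 0); first by [].
    by rewrite /= r21; split; ring.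
  have [p1'|pN1] := eqVneq p 1.
    (* The y, w block is now -1, so solving l M = l divides by 2; the leading 2 clears the
       denominator. *)
    left; exists (Vec4 2 p1 p2 0); first by [].
    by rewrite /= p1' q1N r2N; split; ring.
  have [s1'|sN1] := eqVneq s3 1.
    left; exists (Vec4 0 s1 s2 2); first by [].
    by rewrite /= s1' q1N r2N; split; ring.
  right; rewrite q1N r2N; split=> // a b c d [Ha Hb Hc Hd].
  have b0 : b = 0 by lra.
  have c0 : c = 0 by lra.
  move: Ha Hd; rewrite b0 c0 => Ha Hd; split=> //.
    have /eqP : a * (p - 1) = 0 by lra.
    by rewrite mulf_eq0 subr_eq0 (negPf pN1) orbF => /eqP.
  have /eqP : d * (s3 - 1) = 0 by lra.
  by rewrite mulf_eq0 subr_eq0 (negPf sN1) orbF => /eqP.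
move: eY eW; rewrite {}p0 {}r20 {}s30 {}q10 => eY eW.
have r1E : r1 = 1 \/ r1 = -1 by apply: (@mulz1_pm1 b2); lra.
have q2E : q2 = 1 \/ q2 = -1 by apply: (@mulz1_pm1 c1); lra.
have [rq1|rqN] : r1 * q2 = 1 \/ r1 * q2 = -1.
  by case: r1E q2E => -> [] ->; [left|right|right|left].
  left; exists (Vec4 0 r1 1 0); first by [].
  by split=> /=; lra.
have [sp1|spN1] := eqVneq (s * p3) 1.
  have sE : s = p3.
    have p31 := mulz1_pm1 sp1.
    by case: p31 sp1 => -> ; lra.
  (* The y, w block N satisfies N^2 = -1, so the inverse of 1 - N is (1 + N)/2. This gives the
     middle entries, and the factor 2 clears the denominator. *)
  left; exists (Vec4 2 (p1 + s * s1 + (p2 + s * s2) * r1)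
                  (p2 + s * s2 + (p1 + s * s1) * q2) (2 * s)); first by [].
  rewrite sE in sp1 *; split=> /=; try lra.
    transitivity (2 * (p1 + p3 * s1) + (p2 + p3 * s2) * r1 +
      (p1 + p3 * s1) * (r1 * q2)); first ring.
    by rewrite rqN; ring.
  transitivity (2 * (p2 + p3 * s2) + (p1 + p3 * s1) * q2 +
    (p2 + p3 * s2) * (r1 * q2)); first ring.
  by rewrite rqN; ring.
right; split; first lra.
move=> a b c d [Ha Hb Hc Hd].
have cE : c = b * r1 by lra.
have b0 : b = 0.
  have : b * (r1 * q2) = b by rewrite mulrA -cE; lra.
  by rewrite rqN; lra.
move: cE Ha Hd; rewrite b0 mul0r => -> Ha Hd.
have dE : d = a * s by lra.
have /eqP : a * (s * p3 - 1) = 0 by move: Ha; rewrite dE; lra.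
rewrite mulf_eq0 subr_eq0 (negPf spN1) orbF => /eqP a0.
by split=> //; rewrite dE a0 mul0r.
Qed.

End PathAutomorphism.
End PathForm.

Lemma infinite_reidemeister (G : groupType) (phi : {multiplicative G -> G})
    (a : nat -> G) :
  (forall s m n, s * a m * (phi s)^-1 = a n -> m = n) ->
  reidemeister_number phi = None.
Proof.
move=> aP; rewrite /reidemeister_number; case: pselect => // finO.
case: infinite_nat; pose o n := twisted_orbit phi (a n).
have -> : [set: nat] = o @^-1` twisted_orbits phi.
  by apply/seteqP; split=> n // _; exists (a n).
apply: finite_preimage finO => m n _ _ omn.
have phi1 : phi 1 = 1 by apply: (mulgI (phi 1)); rewrite -gmulfM !mulg1.
have : o n (a n) by exists 1 => //; rewrite mul1g phi1 invg1 mulg1.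
by rewrite -omn => -[s _ /aP].
Qed.

(** * A concrete model of class 2 *)

Section StepTwo.
Local Open Scope ring_scope.
(* The central extension of Z^n by n x n matrices with cocycle               *)
(* (u, v) |-> (E_ij u_i v_j)_ij.                                              *)
Definition step2 (n : nat) (E : 'M[int]_n) : Type := 'rV[int]_n * 'M[int]_n.

Variables (n : nat) (E : 'M[int]_n).

HB.instance Definition _ := Choice.on (step2 E).

Definition step2_form (u v : 'rV[int]_n) : 'M[int]_n :=
  \matrix_(i, j) (E i j * (u ord0 i * v ord0 j)).

Definition step2_one : step2 E := (0, 0).
Definition step2_mul (a b : step2 E) : step2 E :=
  (a.1 + b.1, a.2 + b.2 + step2_form a.1 b.1).
Definition step2_inv (a : step2 E) : step2 E :=
  (- a.1, step2_form a.1 a.1 - a.2).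

Lemma step2_mulA : associative step2_mul.
Proof.
move=> a b c; congr pair; first by rewrite /= addrA.
by apply/matrixP => i j; rewrite !mxE /=; ring.
Qed.

Lemma step2_mul1 : left_id step2_one step2_mul.
Proof.
move=> [u A]; congr pair; first by rewrite /= add0r.
by apply/matrixP => i j; rewrite !mxE /=; ring.
Qed.

Lemma step2_mulr1 : right_id step2_one step2_mul.
Proof.
move=> [u A]; congr pair; first by rewrite /= addr0.
by apply/matrixP => i j; rewrite !mxE /=; ring.
Qed.

Lemma step2_mulV : left_inverse step2_one step2_inv step2_mul.
Proof.
move=> [u A]; congr pair; first by rewrite /= addNr.
by apply/matrixP => i j; rewrite !mxE /=; ring.
Qed.

Lemma step2_mulrV : right_inverse step2_one step2_inv step2_mul.
Proof.
move=> [u A]; congr pair; first by rewrite /= addrN.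
by apply/matrixP => i j; rewrite !mxE /=; ring.
Qed.

HB.instance Definition _ := isGroup.Build (step2 E) step2_mulA
  step2_mul1 step2_mulr1 step2_mulV step2_mulrV.

Lemma step2_commuteP (a b : step2 E) : commute a b <->
  forall i j, E i j * (a.1 ord0 i * b.1 ord0 j - b.1 ord0 i * a.1 ord0 j) = 0.
Proof.
split=> [[_ ab] i j|ab].
  by move/matrixP/(_ i j): ab; rewrite !mxE; lra.
congr pair; first by rewrite /= addrC.
by apply/matrixP => i j; rewrite !mxE; move: (ab i j); lra.
Qed.

Lemma step2_centre (a : step2 E) : a.1 = 0 -> centre a.
Proof. by move=> a0 b; apply/step2_commuteP => i j; rewrite a0 !mxE; ring. Qed.

Lemma step2_commg1 (a b : step2 E) : [~ a, b]%g.1 = 0.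
Proof. by rewrite /= [a.1 + _]addrC addKr addNr. Qed.

Lemma step2_commg2 (a b : step2 E) i j : [~ a, b]%g.2 i j =
  E i j * (a.1 ord0 i * b.1 ord0 j - b.1 ord0 i * a.1 ord0 j).
Proof. by rewrite /= !mxE; ring. Qed.

End StepTwo.

(** * The quotient Q, its coordinates and its centre *)

Section PathQuotient.

Local Notation iX := (@Ordinal 4 0 isT).
Local Notation iY := (@Ordinal 4 1 isT).
Local Notation iZ := (@Ordinal 4 2 isT).
Local Notation iW := (@Ordinal 4 3 isT).

Local Notation Q := (quotient_group relator_nsg).

Lemma ord4_cases (P : 'I_4 -> Prop) :
  P iX -> P iY -> P iZ -> P iW -> forall i, P i.
Proof.
move=> PX PY PZ PW [[|[|[|[|//]]]] lti]; rewrite (bool_irrelevance lti isT);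
assumption.
Qed.

Definition gen (i : 'I_4) : Q := \pi_(Q) (free_nilpotent_gen 2 i).

Lemma Q_ind (A : set Q) : is_subgroup A -> (forall i, A (gen i)) ->
  forall g, A g.
Proof.
move=> [A1 AM AV] Ag; elim/quotW; elim/quotW.
pose p : UMagmaMorphism.type (free_nilpotent 4 2) Q := \pi_(Q).
pose p' : UMagmaMorphism.type (free_group 'I_4) (free_nilpotent 4 2) :=
  \pi_(quotient_group (lower_central_nsg (free_group 'I_4) 3)).
apply: (@free_group_ind _ [set a | A (p (p' a))]) => //.
split=> [|a b|a] /=; rewrite ?gmulf1 // ?gmulfM ?gmulfV //.
  exact: AM.
exact: AV.
Qed.

Lemma Q_commg_central (a b : Q) : centre [~ a, b].
Proof.
move=> c; apply/commgP; rewrite -conjg_fix; apply/eqP.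
elim/quotW: a => a; elim/quotW: b => b; elim/quotW: c => c.
pose p : UMagmaMorphism.type (free_nilpotent 4 2) Q := \pi_(Q).
by rewrite -(gmulfR p a b) -(gmulfJ p _ c) quotient_lower_central3.
Qed.

Lemma Q_relator (i j : 'I_4) :
  [~ free_nilpotent_gen 2 i, free_nilpotent_gen 2 j] \in
    [set [~ free_nilpotent_gen 2 iX, free_nilpotent_gen 2 iZ];
         [~ free_nilpotent_gen 2 iX, free_nilpotent_gen 2 iW];
         [~ free_nilpotent_gen 2 iY, free_nilpotent_gen 2 iZ]] ->
  commute (gen i) (gen j).
Proof.
rewrite inE => ij; apply/commgP/eqP.
pose p : UMagmaMorphism.type (free_nilpotent 4 2) Q := \pi_(Q).
rewrite -(gmulfR p) -[RHS](gmulf1 (s := p)); apply/esym/quotient_eqP/asboolP.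
by rewrite invg1 mul1g; apply: sub_gen_smallest.
Qed.

Lemma commXZ : commute (gen iX) (gen iZ).
Proof. by apply: Q_relator; rewrite inE; left; left. Qed.
Lemma commXW : commute (gen iX) (gen iW).
Proof. by apply: Q_relator; rewrite inE; left; right. Qed.
Lemma commYZ : commute (gen iY) (gen iZ).
Proof. by apply: Q_relator; rewrite inE; right. Qed.

(** The lift from the free group carries the third lower central term into that of H, which is
    trivial as commutators in H are central; the induced map then kills the three relators. *)
Lemma Q_lift (H : groupType) (u : 'I_4 -> H) :
  (forall a b, centre [~ a, b :> H]) ->
  commute (u iX) (u iZ) -> commute (u iX) (u iW) -> commute (u iY) (u iZ) ->
  exists f : UMagmaMorphism.type Q H, forall i, f (gen i) = u i.
Proof.
move=> H2 XZ XW YZ.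
have [a /(@lower_central_morph _ _ (free_lift u))|f fE] :=
    @quotient_lift _ _ (lower_central_nsg (free_group 'I_4) 3) (free_lift u).
  by rewrite lower_central3_eq1.
have fg i : f (free_nilpotent_gen 2 i) = u i.
  by rewrite fE; apply: free_lift_gen.
have [|g gE] := @quotient_lift _ _ relator_nsg f; last first.
  by exists g => i; rewrite gE.
apply: smallest_sub.
  split=> [|a b /= fa fb|a /= fa]; first exact: gmulf1.
    by rewrite gmulfM fa fb mulg1.
  by rewrite gmulfV fa invg1.
by move=> _ [[]|] ->; rewrite /= gmulfR !fg; apply/eqP/commgP.
Qed.

(* The three non-commuting pairs, in the numbering x, y, z, w of 'I_4.        *)
Definition edges : 'M[int]_4 :=
  (delta_mx iX iY + delta_mx iY iW + delta_mx iW iZ)%R.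

(** This image of Q shows that [x, y], [y, w] and [w, z] do not collapse. *)
Lemma Q_coords : exists f : UMagmaMorphism.type Q (step2 edges),
  forall i, f (gen i) = (delta_mx ord0 i, 0%R).
Proof.
apply: Q_lift; first by move=> a b; apply/step2_centre/step2_commg1.
all: apply/step2_commuteP; elim/ord4_cases; elim/ord4_cases;
  rewrite !mxE /=; ring.
Qed.

Definition coords : UMagmaMorphism.type Q (step2 edges) :=
  projT1 (cid Q_coords).
Lemma coords_gen i : coords (gen i) = (delta_mx ord0 i, 0%R).
Proof. exact: (projT2 (cid Q_coords)). Qed.

Definition ab (g : Q) : 'rV[int]_4 := (coords g).1.

Local Open Scope ring_scope.
Lemma abM a b : ab (a * b)%g = ab a + ab b.
Proof. by rewrite /ab gmulfM. Qed.
Lemma ab1 : ab 1%g = 0. Proof. by rewrite /ab gmulf1. Qed.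
Lemma abV a : ab a^-1%g = - ab a. Proof. by rewrite /ab gmulfV. Qed.
Lemma ab_gen i : ab (gen i) = delta_mx ord0 i.
Proof. by rewrite /ab coords_gen. Qed.

Definition vec (g : Q) : vec4 :=
  Vec4 (ab g ord0 iX) (ab g ord0 iY) (ab g ord0 iW) (ab g ord0 iZ).

Definition add4 u v :=
  Vec4 (cx u + cx v) (cy u + cy v) (cw u + cw v) (cz u + cz v).

Lemma vecM a b : vec (a * b)%g = add4 (vec a) (vec b).
Proof. by rewrite /vec abM !mxE. Qed.

Lemma vec_genX : vec (gen iX) = Vec4 1 0 0 0.
Proof. by rewrite /vec ab_gen !mxE. Qed.
Lemma vec_genY : vec (gen iY) = Vec4 0 1 0 0.
Proof. by rewrite /vec ab_gen !mxE. Qed.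
Lemma vec_genW : vec (gen iW) = Vec4 0 0 1 0.
Proof. by rewrite /vec ab_gen !mxE. Qed.
Lemma vec_genZ : vec (gen iZ) = Vec4 0 0 0 1.
Proof. by rewrite /vec ab_gen !mxE. Qed.

Lemma ab0_vec g : vec g = zero4 -> ab g = 0.
Proof.
case=> gX gY gW gZ; apply/rowP; elim/ord4_cases; rewrite [RHS]mxE //.
Qed.

(** Both sides are homomorphisms from Q to the integers that agree on the generators. *)
Lemma additive_coords (u : Q -> int) : (forall a b, u (a * b)%g = u a + u b) ->
  forall g, u g = dot4 (vec g)
    (Vec4 (u (gen iX)) (u (gen iY)) (u (gen iW)) (u (gen iZ))).
Proof.
move=> uM; rewrite /dot4 /=.
have u1 : u 1%g = 0 by have := uM 1%g 1%g; rewrite mulg1; lra.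
have uV a : u a^-1%g = - u a by have := uM a^-1%g a; rewrite mulVg u1; lra.
apply: Q_ind.
  split=> [|a b /= Ha Hb|a /= Ha]; first by rewrite u1 ab1 !mxE; ring.
    by rewrite uM abM Ha Hb !mxE; ring.
  by rewrite uV abV Ha !mxE; ring.
by elim/ord4_cases; rewrite ab_gen !mxE /=; ring.
Qed.

Lemma commute_vec a b : commute a b -> path_commute (vec a) (vec b).
Proof.
move=> /(gmulf_commute coords)/step2_commuteP abE.
split; [move: (abE iX iY)|move: (abE iY iW)|move: (abE iW iZ)];
  rewrite !mxE /= /ab; lra.
Qed.

(** Commuting with a generator kills the coordinates at its neighbours on the path, and every vertex
    is a neighbour of another. *)
Lemma centre_ab g : centre g -> vec g = zero4.
Proof.
move=> Cg; have [cX cY cW cZ] :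
    [/\ path_commute (vec g) (vec (gen iX)),
        path_commute (vec g) (vec (gen iY)),
        path_commute (vec g) (vec (gen iW)) &
        path_commute (vec g) (vec (gen iZ))].
  by split; apply: commute_vec.
move: cX cY cW cZ; rewrite vec_genX vec_genY vec_genW vec_genZ /vec.
move=> [/= X1 X2 X3] [/= Y1 Y2 Y3] [/= W1 W2 W3] [/= Z1 Z2 Z3].
by congr Vec4; lra.
Qed.

Lemma ab_expgz g n : ab (expgz g n) = n *: ab g.
Proof.
have abX k : ab (g ^+ k)%g = k%:Z *: ab g.
  elim: k => [|k IHk]; first by rewrite ab1 scale0r.
  by rewrite expgS abM IHk intS scalerDl scale1r.
by case: n => k /=; rewrite ?abV abX // NegzE scaleNr.
Qed.

Lemma vec_onto v : exists g, vec g = v.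
Proof.
case: v => p q r s.
exists (expgz (gen iX) p * expgz (gen iY) q *
        expgz (gen iW) r * expgz (gen iZ) s)%g.
rewrite /vec !abM !ab_expgz !ab_gen; congr Vec4; rewrite !mxE /=; ring.
Qed.

Lemma Q_commMg (a b h : Q) : [~ a * b, h]%g = ([~ a, h] * [~ b, h])%g.
Proof.
apply: (mulgI (h * (a * b))%g); rewrite -commgC.
have := commgC a h; have := commgC b h; have := Q_commg_central a h b.
move: [~ a, h]%g [~ b, h]%g => c d cb bh ah.
rewrite -mulgA bh !mulgA ah -!mulgA; congr (_ * (_ * _))%g.
by rewrite !mulgA cb.
Qed.

Lemma centre_expgz (G : groupType) (c : G) n : centre c -> centre (expgz c n).
Proof.
move=> Cc h; apply: commute_sym; case: n => k /=; last apply: commuteV;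
  by apply: commuteX; apply: commute_sym.
Qed.

(** For fixed h both sides are multiplicative in g, the factors being central, and they agree on the
    generators. *)
Lemma Q_commg_ab (g h : Q) :
  [~ g, h]%g = (\prod_(i < 4) expgz [~ gen i, h] (ab g ord0 i))%g.
Proof.
set K := fun g => (\prod_(i < 4) expgz [~ gen i, h] (ab g ord0 i))%g.
rewrite -/(K g); have KM a b : K (a * b)%g = (K a * K b)%g.
  rewrite /K -prodgM_commute => [|i j _ _].
    by apply: eq_bigr => i _; rewrite abM mxE expgzD.
  exact/centre_expgz/Q_commg_central.
have K1 : K 1%g = 1%g by apply: (mulgI (K 1%g)); rewrite -KM !mulg1.
have KV a : K a^-1%g = (K a)^-1%g.
  by apply/esym/mulg1_eq; rewrite -KM mulgV.
apply: (Q_ind (A := [set g | [~ g, h]%g = K g])) g.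
  split=> [|a b /= Ha Hb|a /= Ha].
  - by rewrite /= comm1g K1.
  - by rewrite Q_commMg KM Ha Hb.
  - by rewrite KV -Ha; apply/esym/mulg1_eq; rewrite -Q_commMg mulgV comm1g.
by elim/ord4_cases; rewrite /= /K !big_ord_recl big_ord0 ab_gen !mxE /=
  ?mulg1 ?mul1g //; congr [~ gen _, _]%g; apply: val_inj.
Qed.

Lemma vec0_centre g : vec g = zero4 -> centre g.
Proof.
move=> /ab0_vec g0 h; apply/commgP; rewrite Q_commg_ab big1 // => i _.
by rewrite g0 mxE.
Qed.

(* Twice the exponent of [y, w], corrected so that the cocycle of delta       *)
(* becomes the determinant on the coordinates y and w.                        *)
Definition delta (g : Q) : int :=
  2 * (coords g).2 iY iW - cy (vec g) * cw (vec g).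

Lemma deltaM a b : delta (a * b)%g =
  delta a + delta b + (cy (vec a) * cw (vec b) - cw (vec a) * cy (vec b)).
Proof. by rewrite /delta vecM gmulfM /= !mxE /= /ab; ring. Qed.

Definition tYW : Q := [~ gen iY, gen iW]%g.

Lemma vec_tYW k : vec (tYW ^+ k)%g = zero4.
Proof.
apply: centre_ab; apply: (@centre_expgz _ tYW k); exact: Q_commg_central.
Qed.

Lemma delta_tYW k : delta (tYW ^+ k)%g = 2 * k%:Z.
Proof.
elim: k => [|k IHk].
  by rewrite expg0 /delta /vec gmulf1 ab1 !mxE /=; ring.
rewrite expgS deltaM IHk vec_tYW /=.
have -> : delta tYW = 2.
  rewrite /delta (vec_tYW 1) /tYW gmulfR step2_commg2 !coords_gen !mxE /=; ring.
by rewrite [k.+1%:Z]intS; ring.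
Qed.

Lemma tYW_neq1 : tYW <> 1%g.
Proof.
move=> t1; have := delta_tYW 1; have := delta_tYW 0.
by rewrite expg0 expg1 t1 => ->.
Qed.

(** * Nilpotency class and twisted orbits *)

Lemma Q_class2 : has_nilpotency_class Q 2.
Proof.
split; first exact/lower_central3_eq1/Q_commg_central.
have tG2 : lower_central Q 2 tYW.
  by apply: sub_gen_smallest; exists (gen iY), (gen iW).
case=> [|[|//]] _ G1; apply: tYW_neq1; last by move: tG2; rewrite G1.
have : lower_central Q 1 tYW by [].
by rewrite G1.
Qed.

Lemma Q_R_infinity : R_infinity Q.
Proof.
move=> phi phi_bij; have phi_inj := bij_inj phi_bij.
pose F i := vec (phi (gen i)).
have phi_vec g : vec (phi g) = comb4 (cx (vec g)) (cy (vec g)) (cw (vec g))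
    (cz (vec g)) (F iX) (F iY) (F iW) (F iZ).
  rewrite /F; congr Vec4;
  [rewrite [LHS](@additive_coords (fun h => cx (vec (phi h))))
  |rewrite [LHS](@additive_coords (fun h => cy (vec (phi h))))
  |rewrite [LHS](@additive_coords (fun h => cw (vec (phi h))))
  |rewrite [LHS](@additive_coords (fun h => cz (vec (phi h))))]
  => // a b; by rewrite gmulfM vecM.
(* By injectivity phi reflects centrality, so M has trivial kernel. *)
have phi_vec0 g : vec (phi g) = zero4 -> vec g = zero4.
  move=> /vec0_centre Cg; apply: centre_ab => h; apply: phi_inj.
  by rewrite !gmulfM Cg.
have free a b c d : comb4 a b c d (F iX) (F iY) (F iW) (F iZ) = zero4 ->
    [/\ a = 0, b = 0, c = 0 & d = 0].
  have [g gE] := vec_onto (Vec4 a b c d).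
  by have := phi_vec0 g; rewrite phi_vec gE /= => H /H [].
have onto v : exists a b c d, comb4 a b c d (F iX) (F iY) (F iW) (F iZ) = v.
  have [g <-] := vec_onto v; have [psi _ psiK] := phi_bij.
  by rewrite -(psiK g) phi_vec; do 4!eexists.
have comm i j : commute (gen i) (gen j) -> path_commute (F i) (F j).
  by move=> /(gmulf_commute phi)/commute_vec.
clearbody F.
have [[l l0 [lX lY lW lZ]]|[det1 fix0]] := path_aut_fixed free
  (comm _ _ commXZ) (comm _ _ commXW) (comm _ _ commYZ) onto.
  pose u g := dot4 l (vec g).
  have uM a b : u (a * b)%g = u a + u b by rewrite /u vecM /dot4 /=; ring.
  have uphi g : u (phi g) = u g.
    rewrite /u phi_vec; transitivity (dot4 (vec g) (Vec4 (dot4 l (F iX))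
        (dot4 l (F iY)) (dot4 l (F iW)) (dot4 l (F iZ)))).
      by rewrite /dot4 /=; ring.
    by rewrite lX lY lW lZ /dot4 /=; ring.
  have [g ug] : exists g, u g <> 0.
    apply/existsNP => u0; apply: l0.
    move: (u0 (gen iX)) (u0 (gen iY)) (u0 (gen iW)) (u0 (gen iZ)).
    rewrite /u vec_genX vec_genY vec_genW vec_genZ; case: (l) => p q r s.
    by rewrite /dot4 /= => H1 H2 H3 H4; congr Vec4; lra.
  have uX k : u (g ^+ k)%g = k%:Z * u g.
    elim: k => [|k IHk]; first by have := uM 1%g 1%g; rewrite mulg1 expg0; lra.
    by rewrite expgS uM IHk [k.+1%:Z]intS; ring.
  apply: (infinite_reidemeister (a := fun k => g ^+ k)%g) => s m n.
  move=> /(congr1 (fun h => u (h * phi s)%g)).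
  rewrite mulgVK !uM !uphi !uX => umn.
  have /eqP : (m%:Z - n%:Z) * u g = 0 by move: umn; lra.
  by rewrite mulf_eq0 subr_eq0 => /orP[/eqP[]//|/eqP/ug].
pose u g := delta (phi g) - delta g.
have uM a b : u (a * b)%g = u a + u b.
  rewrite /u gmulfM !deltaM !phi_vec /=.
  (* The images of x and z have no y or w coordinate, so phi multiplies the determinant cocycle of
     [delta] by [d1], which is 1. *)
  have [X2 X3 Z2 Z3] := path_aut_ends free
    (comm _ _ commXZ) (comm _ _ commXW) (comm _ _ commYZ).
  rewrite X2 X3 Z2 Z3.
  set d1 := cy (F iY) * cw (F iW) - cw (F iY) * cy (F iW) in det1.
  transitivity (delta (phi a) + delta (phi b) - delta a - delta b +
    (d1 - 1) * (cy (vec a) * cw (vec b) - cw (vec a) * cy (vec b))).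
    by rewrite /d1; ring.
  by rewrite det1; ring.
apply: (infinite_reidemeister (a := fun k => tYW ^+ k)%g) => s m n.
move=> /(congr1 (fun h => (h * phi s)%g)); rewrite mulgVK => smn.
(* Powers of t have zero [vec], so the equation projects to M fixing [vec s]. *)
have s0 : vec s = zero4.
  have vs : vec (phi s) = vec s.
    have := congr1 vec smn; rewrite !vecM !vec_tYW.
    case: (vec s) (vec (phi s)) => ? ? ? ? [? ? ? ?].
    by rewrite /add4 /= !addr0 !add0r => ->.
  move: vs; rewrite phi_vec; case: (vec s) => p q r t /fix0.
  by case=> /= -> -> -> ->.
(* This reads delta(s) + 2m = 2n + delta(phi s), and the additive [u] vanishes at s. *)
have := congr1 delta smn; rewrite !deltaM !vec_tYW !delta_tYW s0 /=.
have : u s = 0 by rewrite additive_coords // s0 /dot4 /=; ring.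
rewrite /u; lia.
Qed.

End PathQuotient.

Theorem mainTheorem6 :
  has_nilpotency_class (quotient_group relator_nsg) 2 /\
  R_infinity (quotient_group relator_nsg).
Proof. by split; [exact: Q_class2|exact: Q_R_infinity]. Qed.
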